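(* Let $p>3$ be a prime with $p\equiv 3\pmod 4$ and let $n\geq 1$ be an integer. Let $E$ be a supersingular elliptic curve over $\mathbb{F}_p$ with $j(E)\neq 1728$. Then there exists a twisting endomorphism $\alpha\in\operatorname{End}(E)$ of degree $n$ if and only if there exists an isogeny $\varphi:E\to E'$ of degree $n$ defined over $\mathbb{F}_p$ such that $E'$ is $\mathbb{F}_p$-isomorphic to the twist $E^t$ of $E$.
   Context: $\operatorname{End}(E)$ denotes the full (geometric) endomorphism ring of $E$ over $\overline{\mathbb{F}}_p$, and $\phi_{p,E}:(x,y)\mapsto(x^p,y^p)$ is the $p$-power Frobenius endomorphism of $E/\mathbb{F}_p$. A twisting endomorphism of a supersingular elliptic curve $E/\mathbb{F}_p$ is an $\alpha\in\operatorname{End}(E)$ with $\phi_{p,E}\circ\alpha=-\alpha\circ\phi_{p,E}$. For $E:y^2=x^3+ax+b$ over $\mathbb{F}_p$ with $j(E)\neq 1728$, the twist is $E^t:y^2=x^3+ax-b$. *)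

(* Defs.v *)
From HB Require Import structures.
From mathcomp Require Import all_boot all_order all_algebra.
From mathcomp Require Import mpoly ring.

Set Implicit Arguments.
Unset Strict Implicit.
Unset Printing Implicit Defensive.

Import GRing.Theory.
Local Open Scope ring_scope.

(* An elliptic curve y^2 = x^3 + a x + b.  The factor 16 of the discriminant
   is kept, so that there is no such curve in characteristic 2.  Over a field
   of characteristic different from 2 and 3 every elliptic curve has a model
   of this form. *)
Record wcurve (F : fieldType) := WCurve {
  wa : F;
  wb : F;
  wdisc : - (16 * (4 * wa ^+ 3 + 27 * wb ^+ 2)) != 0
}.

Definition jinv (F : fieldType) (E : wcurve F) : F :=
  1728 * (4 * wa E ^+ 3) / (4 * wa E ^+ 3 + 27 * wb E ^+ 2).

Lemma twist_disc (F : fieldType) (E : wcurve F) :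
  - (16 * (4 * wa E ^+ 3 + 27 * (- wb E) ^+ 2)) != 0.
Proof. by rewrite sqrrN wdisc. Qed.

Definition twist (F : fieldType) (E : wcurve F) : wcurve F :=
  WCurve (twist_disc E).

Lemma base_change_disc (F K : fieldType) (iota : {rmorphism F -> K})
    (E : wcurve F) :
  - (16 * (4 * iota (wa E) ^+ 3 + 27 * iota (wb E) ^+ 2)) != 0.
Proof.
have -> : - (16 * (4 * iota (wa E) ^+ 3 + 27 * iota (wb E) ^+ 2)) =
    iota (- (16 * (4 * wa E ^+ 3 + 27 * wb E ^+ 2))).
  by rewrite !(rmorph_nat iota, rmorphN iota, rmorphM iota, rmorphD iota, rmorphXn iota).
by rewrite fmorph_eq0 wdisc.
Qed.

Definition base_change (F K : fieldType) (iota : {rmorphism F -> K})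
    (E : wcurve F) : wcurve K :=
  WCurve (base_change_disc iota E).

Section Points.

Variables (K : fieldType) (E : wcurve K).

(* None is the point at infinity. *)
Definition on_curve (P : option (K * K)) : bool :=
  if P is Some (x, y) then y ^+ 2 == x ^+ 3 + wa E * x + wb E else true.

Record point := Point { pcoord :> option (K * K); _ : on_curve pcoord }.

HB.instance Definition _ := [isSub for pcoord].
HB.instance Definition _ := [Choice of point by <:].

Definition pzero : point := @Point None isT.

Definition raw_opp (P : option (K * K)) : option (K * K) :=
  if P is Some (x, y) then Some (x, - y) else None.

Lemma on_curve_opp (P : point) : on_curve (raw_opp P).
Proof. by case: P => -[[x y]|] //= h; rewrite sqrrN. Qed.

Definition popp (P : point) : point := Point (on_curve_opp P).

Definition third (s x1 y1 x2 : K) : K * K :=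
  let x3 := s ^+ 2 - x1 - x2 in (x3, s * (x1 - x3) - y1).

Definition raw_add (P Q : option (K * K)) : option (K * K) :=
  match P, Q with
  | None, _ => Q
  | _, None => P
  | Some (x1, y1), Some (x2, y2) =>
      if x1 != x2 then Some (third ((y2 - y1) / (x2 - x1)) x1 y1 x2)
      else if y1 == - y2 then None
      else Some (third ((3 * x1 ^+ 2 + wa E) / (2 * y1)) x1 y1 x2)
  end.

Lemma on_curve_add (P Q : point) : on_curve (raw_add P Q).
Proof.
case: P => -[[x1 y1]|]; case: Q => -[[x2 y2]|] //= /eqP h2 /eqP h1.
have hb : wb E = y1 ^+ 2 - x1 ^+ 3 - wa E * x1 by rewrite h1; ring.
have two0 : (2 : K) != 0.
  apply/eqP => two0; move: (wdisc E).
  have -> : (16 : K) = 2 * 8 by ring.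
  by rewrite two0 !mul0r oppr0 eqxx.
case: eqP => [ex|/eqP nx] /=; last first.
  have nx' : x2 - x1 != 0 by rewrite subr_eq0 eq_sym.
  have ha : wa E = (y2 ^+ 2 - y1 ^+ 2 - (x2 ^+ 3 - x1 ^+ 3)) / (x2 - x1).
    by rewrite h1 h2; field.
  by apply/eqP; rewrite hb ha; field.
subst x2; case: eqP => //= /eqP ny.
have ey : y1 = y2.
  apply/eqP; rewrite -subr_eq0.
  have : (y1 - y2) * (y1 + y2) == 0.
    by rewrite -subr_sqr h1 h2 subrr.
  rewrite mulf_eq0 => /orP[//|hs].
  by rewrite addr_eq0 (negbTE ny) in hs.
subst y2.
have y0 : y1 != 0 by apply: contraNneq ny => ->; rewrite oppr0.
by apply/eqP; rewrite hb; field; rewrite y0 two0.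
Qed.

Definition padd (P Q : point) : point := Point (on_curve_add P Q).

Definition pmuln (m : nat) (P : point) : point := iter m (padd P) pzero.

Definition hcoord (P : point) : 'I_3 -> K :=
  if pcoord P is Some (x, y) then nth 0 [:: x; y; 1] else nth 0 [:: 0; 1; 0].

(* h and g agree at all but finitely many points. *)
Definition ae_eq (h g : point -> K) : Prop :=
  exists s : seq point, forall P, P \notin s -> h P = g P.

(* h is a rational function F / G with F, G homogeneous of the same degree and
   G not identically zero on E; the values of h at the zeros of G are
   irrelevant.  When K is algebraically closed, the function field K(E) is the
   set of such h modulo ae_eq. *)
Definition rational_fun (h : point -> K) : Prop :=
  exists (d : nat) (F G : {mpoly K[3]}),
    [/\ F \is d.-homog, G \is d.-homog,
        exists P, G.@[hcoord P] != 0
      & forall P, G.@[hcoord P] != 0 -> h P = F.@[hcoord P] / G.@[hcoord P]].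

End Points.

Arguments pzero {K E}.

(* F = [F_0 : F_1 : F_2], with F_i homogeneous of the same degree, is defined
   at P and gives f wherever it is defined. *)
Definition represents_at (K : fieldType) (E E' : wcurve K)
    (f : point E -> point E') (F : 'I_3 -> {mpoly K[3]}) (P : point E) : Prop :=
  [/\ exists d : nat, forall i, F i \is d.-homog,
      exists i, (F i).@[hcoord P] != 0
    & forall Q : point E, (exists i, (F i).@[hcoord Q] != 0) ->
        exists2 c : K, c != 0 &
          forall i, (F i).@[hcoord Q] = c * hcoord (f Q) i].

(* For K algebraically closed: morphisms of varieties E -> E' preserving the
   base point, the zero morphism included. *)
Record ec_hom (K : fieldType) (E E' : wcurve K) := ECHom {
  hom_fun :> point E -> point E';
  hom_regular : forall P, exists F, represents_at hom_fun F P;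
  hom_zero : hom_fun pzero = pzero
}.

Definition ec_end (K : fieldType) (E : wcurve K) := ec_hom E E.

(* A nonconstant morphism preserving the base point. *)
Definition isogeny (K : fieldType) (E E' : wcurve K) (f : ec_hom E E') : Prop :=
  exists P, f P <> pzero.

(* [K(E) : f^* K(E')] = n: the functions b_1, ..., b_n form a basis of K(E)
   over the subfield f^* K(E') = { c \o f | c in K(E') }. *)
Definition pullback_degree (K : fieldType) (E E' : wcurve K)
    (f : point E -> point E') (n : nat) : Prop :=
  exists b : 'I_n -> point E -> K,
    [/\ forall i, rational_fun (b i),
        forall h, rational_fun h ->
          exists2 c : 'I_n -> point E' -> K, forall i, rational_fun (c i) &
            ae_eq h (fun P => \sum_i c i (f P) * b i P)
      & forall c : 'I_n -> point E' -> K, (forall i, rational_fun (c i)) ->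
          ae_eq (fun P => \sum_i c i (f P) * b i P) (fun=> 0) ->
          forall i, ae_eq (c i) (fun=> 0)].

(* By convention the zero morphism has degree 0. *)
Definition has_degree (K : fieldType) (E E' : wcurve K) (f : ec_hom E E')
    (n : nat) : Prop :=
  (isogeny f /\ pullback_degree f n) \/ (~ isogeny f /\ n = 0%N).

Section OverSubfield.

Variables (k K : fieldType) (iota : {rmorphism k -> K}).

(* Near every point f is given by polynomials with coefficients in k. *)
Definition defined_over (E E' : wcurve k)
    (f : ec_hom (base_change iota E) (base_change iota E')) : Prop :=
  forall P, exists F : 'I_3 -> {mpoly k[3]},
    represents_at f (fun i => map_mpoly iota (F i)) P.

Definition isomorphic_over (E E' : wcurve k) : Prop :=
  exists (f : ec_hom (base_change iota E) (base_change iota E'))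
         (g : ec_hom (base_change iota E') (base_change iota E)),
    [/\ defined_over f, defined_over g, cancel f g & cancel g f].

End OverSubfield.

Section Frobenius.

Variables (p : nat) (K : fieldType) (iota : {rmorphism 'F_p -> K}).
Hypothesis p_prime : prime p.
Variable E : wcurve 'F_p.

Let EK := base_change iota E.

Lemma pchar_target : p \in [pchar K].
Proof. exact: (rmorph_pchar iota (pchar_Fp p_prime)). Qed.

Lemma frob_Fp (c : 'F_p) : iota c ^+ p = iota c.
Proof.
by rewrite -(natr_Zp c) rmorph_nat -(pFrobenius_autE pchar_target) rmorph_nat.
Qed.

Definition raw_frob (P : option (K * K)) : option (K * K) :=
  if P is Some (x, y) then Some (x ^+ p, y ^+ p) else None.

Lemma on_curve_frob (P : point EK) : on_curve EK (raw_frob P).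
Proof.
case: P => -[[x y]|] //= /eqP h; apply/eqP.
rewrite -exprM mulnC exprM h -!(pFrobenius_autE pchar_target).
by rewrite !rmorphD rmorphXn rmorphM /= !(pFrobenius_autE, frob_Fp).
Qed.

Definition frob_fun (P : point EK) : point EK := Point (on_curve_frob P).

Lemma frob_regular (P : point EK) : exists F, represents_at frob_fun F P.
Proof.
exists (fun i => 'X_i ^+ p).
have hE (Q : point EK) i :
    ('X_i ^+ p : {mpoly K[3]}).@[hcoord Q] = hcoord (frob_fun Q) i.
  have p0 : (0 : K) ^+ p = 0 by rewrite expr0n; case: p p_prime.
  rewrite rmorphXn /= mevalXU /hcoord /=.
  case: Q => -[[x y]|] hQ /=;
    by case: i => -[|[|[|]]] //= _; rewrite ?expr1n.
split; first 2 last.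
- by move=> Q _; exists 1; [exact: oner_neq0 | move=> i; rewrite mul1r hE].
- by exists (1 * p)%N => i; apply: dhomogMn; rewrite dhomogX /= mdeg1.
case: P => -[[x y]|] hP.
- by exists (inord 2); rewrite hE /hcoord /= inordK // oner_neq0.
- by exists (inord 1); rewrite hE /hcoord /= inordK // oner_neq0.
Qed.

Lemma frob_zero : frob_fun pzero = pzero.
Proof. exact: val_inj. Qed.

Definition frob : ec_end EK :=
  @ECHom K EK EK frob_fun frob_regular frob_zero.

Definition twisting (alpha : ec_end EK) : Prop :=
  forall P, frob (alpha P) = popp (alpha (frob P)).

(* E[p] is trivial over the algebraically closed field K. *)
Definition supersingular : Prop :=
  forall P : point EK, pmuln p P = pzero -> P = pzero.

End Frobenius.

(* Main.v *)
(* Let u be a square root of -1.  The isomorphism tau : (x, y) |-> (- x, u y)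
   from E to its twist anticommutes with Frobenius, since u^p = - u for
   p = 3 mod 4.  So alpha is twisting if and only if tau o alpha commutes with
   Frobenius, that is, is defined over F_p; the degree is unchanged. *)
Require Import Defs.
From mathcomp Require Import all_boot all_order all_algebra.
From mathcomp Require Import separable mpoly ring.

Set Implicit Arguments.
Unset Strict Implicit.
Unset Printing Implicit Defensive.

Import GRing.Theory.
Local Open Scope ring_scope.

(** * Evaluation and substitution of homogeneous polynomials *)

Lemma meval_dhomogZ (n : nat) (R : comNzRingType) (d : nat) (q : {mpoly R[n]})
    (c : R) (v w : 'I_n -> R) :
  q \is d.-homog -> (forall i, w i = c * v i) -> q.@[w] = c ^+ d * q.@[v].
Proof.
move=> hq hw; rewrite !mevalE mulr_sumr [LHS]big_seq [RHS]big_seq.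
apply: eq_bigr => m /(dhomog_mf hq) /= <-.
rewrite mulrCA; congr (_ * _); rewrite mdegE -prodrXr -big_split /=.
by apply: eq_bigr => i _; rewrite hw exprMn.
Qed.

Lemma meval_map_mpoly (n : nat) (R S : comNzRingType) (f : {rmorphism R -> S})
    (q : {mpoly R[n]}) (v : 'I_n -> R) (w : 'I_n -> S) :
  (forall i, w i = f (v i)) -> (map_mpoly f q).@[w] = f q.@[v].
Proof.
move=> hw; rewrite {1}[q]mpolyE (raddf_sum (map_mpoly f)) raddf_sum /=.
rewrite (mevalE v) rmorph_sum.
apply: eq_bigr => m _; rewrite map_mpolyZ map_mpolyX mevalZ mevalX rmorphM.
rewrite rmorph_prod; congr (_ * _); apply: eq_bigr => i _.
by rewrite hw rmorphXn.
Qed.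

Lemma dhomog_comp_mpoly (n k : nat) (R : comNzRingType) (d e : nat)
    (q : {mpoly R[n]}) (F : n.-tuple {mpoly R[k]}) :
  q \is e.-homog -> (forall i, tnth F i \is d.-homog) ->
  q \mPo F \is (d * e).-homog.
Proof.
move=> hq hF; rewrite comp_mpolyE big_seq; apply: rpred_sum => m hm.
apply: dhomogZ; rewrite -(dhomog_mf hq hm) /= mdegE big_distrr /=.
elim/big_rec2: _ => [|i a b _ hb]; first exact: dhomog1.
by apply: dhomogM => //; apply: dhomogMn.
Qed.

Lemma dhomog_map_mpoly (n : nat) (R S : nzRingType) (f : {additive R -> S}) d
    (q : {mpoly R[n]}) :
  q \is d.-homog -> map_mpoly f q \is d.-homog.
Proof.
move=> hq; apply/dhomogP => m; rewrite mcoeff_msupp mcoeff_map_mpoly => hm.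
by apply: (dhomog_mf hq); rewrite mcoeff_msupp; apply: contraNneq hm => ->; rewrite raddf0.
Qed.

(** * Morphisms of curves: composition, pullback of functions, degree *)

Section Morphisms.

Variable K : fieldType.
Implicit Types E : wcurve K.

Lemma hcoord_neq0 E (P : point E) : exists i, hcoord P i != 0.
Proof.
case: P => -[[x y]|] hP.
- by exists (inord 2); rewrite /hcoord /= inordK // oner_neq0.
- by exists (inord 1); rewrite /hcoord /= inordK // oner_neq0.
Qed.

(** The entry 1 in each [hcoord] fixes the scalar: it is 1 between affine points, and no scalar
    relates an affine point to infinity. *)
Lemma hcoord_inj E (P Q : point E) (c : K) :
  (forall i, hcoord P i = c * hcoord Q i) -> P = Q.
Proof.
case: P Q => -[[x y]|] hP [[[x' y']|] hQ] h; apply: val_inj => //=;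
  move: (h (inord 0)) (h (inord 1)) (h (inord 2));
  rewrite /hcoord /= !inordK //= ?mulr1 ?mulr0 => h0 h1 h2.
- by move: h0 h1; rewrite -h2 !mul1r => -> ->.
- by move/eqP: h2; rewrite oner_eq0.
- by move/eqP: h1; rewrite -h2 mul0r oner_eq0.
Qed.

(* Unlike in [represents_at], F may vanish at some (or all) points. *)
Definition proportional_to E E' (f : point E -> point E')
    (F : 'I_3 -> {mpoly K[3]}) : Prop :=
  forall Q : point E, exists c : K, forall i, (F i).@[hcoord Q] = c * hcoord (f Q) i.

(** Allowing [c = 0] where all [F i] vanish gives a condition stable under sums and conjugation, as
    the descent requires. *)
Lemma represents_atP E E' (f : point E -> point E') F P :
  represents_at f F P <->
  [/\ exists d : nat, forall i, F i \is d.-homog,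
      exists i, (F i).@[hcoord P] != 0 & proportional_to f F].
Proof.
split=> -[hd hP hF]; split=> // Q.
  have [i hi|hQ] := pickP (fun i => (F i).@[hcoord Q] != 0).
    by have [|c _ hc] := hF Q; [exists i | exists c].
  by exists 0 => i; rewrite mul0r; apply/eqP; rewrite -[_ == _]negbK hQ.
case=> i hi; have [c hc] := hF Q; exists c => //.
by apply: contraNneq hi => c0; rewrite hc c0 mul0r.
Qed.

Section Composition.

Variables (E E' E'' : wcurve K) (f : ec_hom E E') (g : ec_hom E' E'').

(** Polynomials for [f] at [P] are substituted into polynomials for [g] at [f P]; by homogeneity a
    factor [c] on the coordinates becomes [c ^+ e]. *)
Lemma comp_regular P :
  exists F, represents_at (fun Q => g (f Q)) F P.
Proof.
have [F /represents_atP [[d hF] [i hi] pF]] := hom_regular f P.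
have [G /represents_atP [[e hG] [j hj] pG]] := hom_regular g (f P).
have evalE (Q : point E) c (hc : forall i, (F i).@[hcoord Q] = c * hcoord (f Q) i) l :
    (G l \mPo [tuple F k | k < 3]).@[hcoord Q] = c ^+ e * (G l).@[hcoord (f Q)].
  rewrite comp_mpoly_meval; apply: meval_dhomogZ => // k.
  by rewrite tnth_mktuple hc.
exists (fun l => G l \mPo [tuple F k | k < 3]); apply/represents_atP; split.
- exists (d * e)%N => l; apply: dhomog_comp_mpoly => // k.
  by rewrite tnth_mktuple.
- have [c hc] := pF P; exists j; rewrite (evalE _ c) // mulf_neq0 // expf_neq0 //.
  by apply: contraNneq hi => c0; rewrite hc c0 mul0r.
- move=> Q; have [c hc] := pF Q; have [b hb] := pG (f Q).
  by exists (c ^+ e * b) => l; rewrite (evalE _ c) // hb mulrA.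
Qed.

Lemma comp_zero : g (f pzero) = pzero.
Proof. by rewrite !hom_zero. Qed.

Definition comp_hom : ec_hom E E'' := ECHom comp_regular comp_zero.

(** Surjectivity gives a point above one where the denominator is nonzero, so the pulled-back
    denominator does not vanish identically. A single [F], chosen at that point, is enough, since
    the factors [c ^+ d] cancel in the quotient. *)
Lemma rational_fun_comp (h : point E'' -> K) :
  (forall Q, exists P, g P = Q) -> rational_fun h -> rational_fun (h \o g).
Proof.
move=> surj [d [A [B [hA hB [Q BQ] hAB]]]].
have [P gP] := surj Q.
have [F /represents_atP [[e hF] [i hi] pF]] := hom_regular g P.
have evalE q (hq : q \is d.-homog) (R : point E') c
    (hc : forall i, (F i).@[hcoord R] = c * hcoord (g R) i) :
    (q \mPo [tuple F k | k < 3]).@[hcoord R] = c ^+ d * q.@[hcoord (g R)].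
  rewrite comp_mpoly_meval; apply: meval_dhomogZ => // k.
  by rewrite tnth_mktuple hc.
have homF k : tnth [tuple F k | k < 3] k \is e.-homog by rewrite tnth_mktuple.
exists (e * d)%N, (A \mPo [tuple F k | k < 3]), (B \mPo [tuple F k | k < 3]).
split; try exact: dhomog_comp_mpoly.
- have [c hc] := pF P; exists P; rewrite (evalE _ hB _ c) // gP mulf_neq0 // expf_neq0 //.
  by apply: contraNneq hi => c0; rewrite hc c0 mul0r.
- move=> R; have [c hc] := pF R; rewrite !(evalE _ _ _ c) // mulf_eq0 negb_or.
  by case/andP=> cd0 BR /=; rewrite hAB // -mulf_div divff // mul1r.
Qed.

End Composition.

(** The basis [b] is kept: composing coefficients with [g] and [g'] identifies the subfields pulled
    back along [f] and along [g \o f]. *)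
Lemma pullback_degree_comp_iso E E' E'' (f : point E -> point E')
    (g : ec_hom E' E'') (g' : ec_hom E'' E') n :
  cancel g g' -> cancel g' g ->
  pullback_degree f n -> pullback_degree (g \o f) n.
Proof.
move=> gK g'K [b [rat_b span_b free_b]]; exists b; split=> //.
- move=> h /span_b [c rat_c [s hs]].
  exists (fun i => c i \o g') => [i|].
    by apply: rational_fun_comp => // Q; exists (g Q).
  exists s => P /hs ->; apply: eq_bigr => i _ /=; by rewrite gK.
- move=> c rat_c c0 i.
  have [||s hs] := free_b (fun i => c i \o g) _ _ i => //.
    by move=> j; apply: rational_fun_comp => // Q; exists (g' Q).
  (* The finite exceptional set is carried along by the bijection [g]. *)
  exists (map g s) => Q; rewrite -(g'K Q) mem_map; last exact: can_inj gK.
  exact: hs.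
Qed.

Lemma has_degree_comp_iso E E' E'' (f : ec_hom E E')
    (g : ec_hom E' E'') (g' : ec_hom E'' E') n :
  cancel g g' -> cancel g' g ->
  (0 < n)%N -> has_degree f n ->
  isogeny (comp_hom f g) /\ has_degree (comp_hom f g) n.
Proof.
move=> gK g'K n_gt0 [[[P fP] deg_f]|[_ n0]]; last by rewrite n0 in n_gt0.
have iso_gf : isogeny (comp_hom f g).
  by exists P => /= gfP; apply: fP; rewrite -[f P]gK gfP hom_zero.
by split=> //; left; split=> //; apply: pullback_degree_comp_iso deg_f.
Qed.

End Morphisms.

(** * Roots in algebraically closed fields, and periods of maps *)

Lemma closed_field_exprS_surj (K : closedFieldType) m (a : K) :
  exists b, b ^+ m.+1 = a.
Proof.
have : size ('X^(m.+1) - a%:P) != 1 by rewrite size_XnsubC.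
case/closed_rootP=> b; rewrite rootE !hornerE subr_eq0 => /eqP; by exists b.
Qed.

(** As [q] is 0 in [K], the derivative of ['X^q - 'X] is [-1], so this polynomial has [q] distinct
    roots, too many for [g]. *)
Lemma Xq_subX_nonroot (K : closedFieldType) (q : nat) (g : {poly K}) :
  q%:R = 0 :> K -> (1 < q)%N -> g != 0 -> (size g <= q)%N ->
  exists2 x : K, x ^+ q = x & ~~ root g x.
Proof.
move=> q0 q_gt1 g0 size_g.
have size_f : size ('X^q - 'X : {poly K}) = q.+1.
  by rewrite size_polyDl size_polyXn // size_polyN size_polyX ltnS.
have [r def_f] := closed_field_poly_normal ('X^q - 'X : {poly K}).
have lead_f : lead_coef ('X^q - 'X : {poly K}) = 1.
  by rewrite lead_coefDl ?lead_coefXn // size_polyN size_polyX size_polyXn.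
rewrite lead_f scale1r in def_f.
have uniq_r : uniq r.
  rewrite -separable_prod_XsubC -def_f separable_poly.unlock derivB derivXn derivX.
  by rewrite -scaler_nat q0 scale0r sub0r -(scaleN1r 1) coprimepZr ?coprimep1 // oppr_eq0 oner_eq0.
have [x x_r gx] : exists2 x, x \in r & ~~ root g x.
  apply/hasP; rewrite has_predC; apply: contraTN size_g => all_r.
  rewrite -ltnNge (leq_trans _ (max_poly_roots g0 all_r uniq_r)) //.
  by rewrite -size_f def_f size_prod_XsubC.
exists x => //; have : root ('X^q - 'X) x by rewrite def_f root_prod_XsubC.
by rewrite rootE !hornerE subr_eq0 => /eqP.
Qed.

Lemma common_period (T : eqType) (f : T -> T) (s : seq T) :
  (forall x, exists2 m, (0 < m)%N & iter m f x = x) ->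
  exists2 m, (0 < m)%N & {in s, forall x, iter m f x = x}.
Proof.
move=> per; elim: s => [|x s [m m_gt0 hm]]; first by exists 1%N.
have [l l_gt0 hl] := per x; exists (l * m)%N; first by rewrite muln_gt0 l_gt0.
move=> y; rewrite inE => /orP[/eqP->|/hm ys]; last by rewrite iterM iter_fix.
by rewrite mulnC iterM iter_fix.
Qed.

(** * The p-power map on [K]: orbits, fixed elements, action on polynomials and points *)

Section Frobenius.

Variables (p : nat) (K : closedFieldType) (iota : {rmorphism 'F_p -> K}).
Hypothesis p_prime : prime p.

Let sigma : {rmorphism K -> K} := pFrobenius_aut (pchar_target iota p_prime).

Lemma iter_sigmaE k x : iter k sigma x = x ^+ (p ^ k).
Proof. by elim: k => //= k ->; rewrite pFrobenius_autE -exprM expnSr. Qed.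

Lemma sigma_iota c : sigma (iota c) = iota c.
Proof. exact: frob_Fp. Qed.

(** The iterates of [x] stay among the finitely many roots of a polynomial over ['F_p], so two of
    them coincide; injectivity of [sigma] then brings the coincidence back to [x]. *)
Lemma sigma_periodic (K_alg : integralRange iota) x :
  exists2 m, (0 < m)%N & iter m sigma x = x.
Proof.
have [q q_monic qx] := K_alg x.
have q0 : map_poly iota q != 0 by rewrite map_poly_eq0 monic_neq0.
have root_iter k : root (map_poly iota q) (iter k sigma x).
  elim: k => //= k /(rmorph_root sigma); rewrite -map_poly_comp.
  by congr (root _ _); apply: eq_map_poly => c; exact: frob_Fp.
pose n := size (map_poly iota q).
have : ~~ uniq (traject sigma x n.+1).
  apply/negP => uniq_t; have := max_poly_roots q0 _ uniq_t.
  rewrite size_traject ltnNge leqnSn => h; apply: notF; apply: h.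
  by apply/allP => y /trajectP [i _ ->].
rewrite looping_uniq negbK => /trajectP [i i_lt e].
exists (n - i)%N; first by rewrite subn_gt0.
have inj_iter : injective (iter i sigma) by elim: (i) => //= j hj y z /fmorph_inj /hj.
by apply: inj_iter; rewrite -iterD subnKC ?(ltnW i_lt).
Qed.

(** The elements of ['F_p] already provide [p] roots of ['X^p - 'X]; one more would exceed the
    degree. *)
Lemma sigma_fixed x : sigma x = x -> exists c, iota c = x.
Proof.
move=> fix_x; have [|nx] := boolP (x \in [seq iota c | c <- enum 'F_p]).
  by case/mapP=> c _ ->; exists c.
have p_gt1 := prime_gt1 p_prime.
have size_f : size ('X^p - 'X : {poly K}) = p.+1.
  by rewrite size_polyDl size_polyXn // size_polyN size_polyX ltnS.
have f0 : 'X^p - 'X != 0 :> {poly K} by rewrite -size_poly_eq0 size_f.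
have := @max_poly_roots _ _ (x :: [seq iota c | c <- enum 'F_p]) f0.
rewrite size_f /= size_map -cardE card_Fp // ltnn nx map_inj_uniq; last exact: fmorph_inj.
rewrite enum_uniq => h; suff: false by []; apply: h => //.
rewrite rootE !hornerE -[x ^+ p]/(sigma x) fix_x subrr eqxx /=.
by apply/allP => y /mapP [c _ ->]; rewrite rootE !hornerE frob_Fp ?subrr.
Qed.

Lemma map_mpoly_sigma_fixed n (q : {mpoly K[n]}) :
  map_mpoly sigma q = q -> exists q0, map_mpoly iota q0 = q.
Proof.
move=> fix_q.
have coef_q m : exists c, iota c = q@_m.
  by apply: sigma_fixed; rewrite -(mcoeff_map_mpoly sigma) fix_q.
pose g m := sval (sig_eqW (coef_q m)).
exists (\sum_(m <- msupp q) g m *: 'X_[m]).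
rewrite raddf_sum /= [RHS]mpolyE; apply: eq_bigr => m _.
rewrite map_mpolyZ map_mpolyX; congr (_ *: _).
exact: svalP (sig_eqW (coef_q m)).
Qed.

(** A common period of the finitely many nonzero coefficients is a period of [q]. *)
Lemma map_sigma_periodic (K_alg : integralRange iota) n (q : {mpoly K[n]}) :
  exists2 m, (0 < m)%N & iter m (map_mpoly sigma) q = q.
Proof.
have [m m_gt0 hm] := common_period [seq q@_u | u <- msupp q] (sigma_periodic K_alg).
exists m => //; apply/mpolyP => u.
have -> : (iter m (map_mpoly sigma) q)@_u = iter m sigma q@_u.
  by elim: (m) => //= k <-; rewrite mcoeff_map_mpoly.
have [uq|/memN_msupp_eq0 ->] := boolP (u \in msupp q); first by apply: hm; apply: map_f.
by rewrite iter_fix // rmorph0.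
Qed.

Lemma iter_map_sigmaZ n k c (q : {mpoly K[n]}) :
  iter k (map_mpoly sigma) (c *: q) = iter k sigma c *: iter k (map_mpoly sigma) q.
Proof. by elim: k => //= k ->; rewrite map_mpolyZ. Qed.

Lemma hcoord_frob (E : wcurve 'F_p) (P : point (base_change iota E)) i :
  hcoord (frob_fun p_prime P) i = sigma (hcoord P i).
Proof.
by case: P => -[[x y]|] hP; case: i => -[|[|[|]]] //= lti;
  rewrite /hcoord /= ?rmorph0 ?rmorph1.
Qed.

(** The p-th roots of the coordinates satisfy the curve equation because it holds after applying the
    injective [sigma]. *)
Lemma frob_surj (E : wcurve 'F_p) (Q : point (base_change iota E)) :
  exists P, frob_fun p_prime P = Q.
Proof.
case: Q => -[[x y]|] hQ; last by exists pzero; apply: val_inj.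
have p_gt0 := prime_gt0 p_prime.
have [u hu] := closed_field_exprS_surj p.-1 x.
have [v hv] := closed_field_exprS_surj p.-1 y.
rewrite prednK // in hu hv.
have huv : on_curve (base_change iota E) (Some (u, v)).
  apply/eqP/(fmorph_inj sigma); move/eqP: hQ => /= hQ.
  rewrite !(rmorphXn, rmorphD, rmorphM) /=.
  by rewrite !pFrobenius_autE hu hv !frob_Fp.
by exists (Point huv); apply: val_inj; rewrite /= hu hv.
Qed.

(** * Descent to ['F_p] of morphisms that commute with Frobenius *)

Section Descent.

Variables (E E' : wcurve 'F_p).
Let EK := base_change iota E.
Let E'K := base_change iota E'.

(** Polynomials over ['F_p] are fixed by [sigma], so their values at the Frobenius image of [P] are
    the conjugates of their values at [P]. *)
Lemma frob_commute (f : ec_hom EK E'K) :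
  defined_over f -> forall P, f (frob_fun p_prime P) = frob_fun p_prime (f P).
Proof.
move=> def_f P; have [F /represents_atP [_ [i hi] pF]] := def_f P.
have [c hc] := pF P; have [d hd] := pF (frob_fun p_prime P).
have c0 : sigma c != 0.
  by rewrite fmorph_eq0; apply: contraNneq hi => c0; rewrite hc c0 mul0r.
have sigmaF j : map_mpoly sigma (map_mpoly iota (F j)) = map_mpoly iota (F j).
  by apply/mpolyP => m; rewrite !mcoeff_map_mpoly; exact: sigma_iota.
(* Both [d] times the left point and [sigma c] times the right one equal the value of [F] at
   [frob_fun p_prime P], whence this ratio. *)
apply/esym/(@hcoord_inj _ _ _ _ (d / sigma c)) => j.
apply: (mulfI c0); rewrite mulrA mulrCA divff // mulr1 -hd hcoord_frob -rmorphM -hc.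
rewrite -(meval_map_mpoly _ (w := hcoord (frob_fun p_prime P))) ?sigmaF // => l.
exact: hcoord_frob.
Qed.

Variable f : point EK -> point E'K.
Hypothesis f_frob : forall P, f (frob_fun p_prime P) = frob_fun p_prime (f P).

(** Every point is a Frobenius image, and there the conjugated polynomials take conjugated values;
    commutation of [f] with Frobenius matches the right-hand sides. *)
Lemma proportional_iter_sigma F k :
  proportional_to f F -> proportional_to f (fun i => iter k (map_mpoly sigma) (F i)).
Proof.
move=> pF; elim: k => //= k IH Q; have [P <-] := frob_surj Q.
have [c hc] := IH P; exists (sigma c) => i.
rewrite f_frob hcoord_frob -rmorphM -hc.
by apply: meval_map_mpoly => l; apply: hcoord_frob.
Qed.

(* The trace of lambda F has coefficients in F_p and is proportional to f
   everywhere; its value at P is a nonzero polynomial of degree < p^m in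
   lambda, hence is nonzero for some lambda in the field with p^m elements. *)
Lemma represents_at_descent (K_alg : integralRange iota) F P :
  represents_at f F P ->
  exists F0 : 'I_3 -> {mpoly 'F_p[3]},
    represents_at f (fun i => map_mpoly iota (F0 i)) P.
Proof.
case/represents_atP=> [[d hF] [i0 hi0] pF].
pose conj := map_mpoly (n := 3) sigma.
have [m m_gt0 perF] := common_period [seq F i | i : 'I_3] (@map_sigma_periodic K_alg 3).
have {}perF i : iter m conj (F i) = F i by apply: perF; apply: image_f.
have [j hj] := hcoord_neq0 (f P).
pose a k := (iter k conj (F j)).@[hcoord P] / hcoord (f P) j.
have aE k i : (iter k conj (F i)).@[hcoord P] = a k * hcoord (f P) i.
  have [c hc] := proportional_iter_sigma k pF P.
  by rewrite /a !hc mulfK.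
(* At [P], the trace of [x *: F i] takes the value [g.[x] * hcoord (f P) i]. *)
pose g := \sum_(k < m) a k *: 'X^(p ^ k).
have p_gt1 := prime_gt1 p_prime.
have g0 : g != 0.
  (* Only [k = 0] contributes to the coefficient of ['X], and [a 0] is nonzero because [F] does not
     vanish at [P]. *)
  have: g`_1 != 0; last by apply: contraNneq => ->; rewrite coef0.
  rewrite coef_sum (bigD1 (Ordinal m_gt0)) //= big1 => [|k k0].
    rewrite addr0 coefZ coefXn mulr1; apply: contraNneq hi0 => a0.
    by rewrite (aE 0%N) a0 mul0r.
  rewrite coefZ coefXn -(expn0 p) eqn_exp2l // eq_sym.
  by rewrite (_ : _ == _ = false) ?mulr0 //; apply: negbTE.
have size_g : (size g <= p ^ m)%N.
  apply: (leq_trans (size_sum _ _ _)); apply/bigmax_leqP => k _.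
  by rewrite (leq_trans (size_scale_leq _ _)) // size_polyXn ltn_exp2l.
have pm0 : (p ^ m)%:R = 0 :> K.
  by rewrite natrX (pcharf0 (pchar_target iota p_prime)) expr0n gtn_eqF.
have [|x fix_x gx] := Xq_subX_nonroot pm0 _ g0 size_g.
  by rewrite -(expn0 p) ltn_exp2l.
pose T i := \sum_(k < m) iter k conj (x *: F i).
have fixT i : map_mpoly sigma (T i) = T i.
  rewrite /T raddf_sum /=; case: (m) m_gt0 fix_x perF => // l _ fix_x perF.
  (* [sigma] shifts the terms cyclically: the last one becomes the first, since [x] and [F i] are
     both fixed by the m-fold iterate. *)
  rewrite [LHS]big_ord_recr [RHS]big_ord_recl /= addrC; congr (_ + _).
  by rewrite -[LHS]/(iter l.+1 conj _) iter_map_sigmaZ iter_sigmaE fix_x perF.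
have [F0 hF0] := fin_all_exists (fun i => map_mpoly_sigma_fixed (fixT i)).
exists F0; apply/represents_atP; split.
- exists d => i; rewrite hF0; apply: rpred_sum => k _.
  rewrite iter_map_sigmaZ; apply: dhomogZ.
  by elim: (k : nat) => //= l; apply: dhomog_map_mpoly.
- exists j; rewrite hF0 raddf_sum /=.
  under eq_bigr do rewrite iter_map_sigmaZ mevalZ aE mulrA.
  rewrite -mulr_suml mulf_neq0 //; apply: contra gx; rewrite rootE horner_sum.
  by under [in X in _ -> X]eq_bigr do rewrite hornerZ hornerXn mulrC -iter_sigmaE.
(* All conjugates are proportional to the same vector [hcoord (f Q)], hence so is their sum; a
   nonzero coordinate [l] gives the scalar. *)
- move=> Q; have [l hl] := hcoord_neq0 (f Q).
  exists ((T l).@[hcoord Q] / hcoord (f Q) l) => i; rewrite hF0 !raddf_sum /=.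
  rewrite !mulr_suml; apply: eq_bigr => k _.
  have [c hc] := proportional_iter_sigma k pF Q.
  by rewrite !iter_map_sigmaZ !mevalZ !hc !mulrA mulfK.
Qed.

End Descent.

End Frobenius.

(** * The isomorphism with the twist over [K] *)

Section Twist.

Variables (p : nat) (K : closedFieldType) (iota : {rmorphism 'F_p -> K}).
Hypothesis p_prime : prime p.

Section Map.

Variables (E E' : wcurve 'F_p) (u : K).
Let EK := base_change iota E.
Let E'K := base_change iota E'.
Hypothesis u2 : u ^+ 2 = -1.
Hypothesis wa_eq : wa E' = wa E.
Hypothesis wb_eq : wb E' = - wb E.

(** The target is any [E'] with the right coefficients, not [twist E] itself, so that the same
    construction also gives the inverse, which starts from the twist. *)
Definition raw_twist (P : option (K * K)) : option (K * K) :=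
  if P is Some (x, y) then Some (- x, u * y) else None.

Lemma on_curve_twist (P : point EK) : on_curve E'K (raw_twist P).
Proof.
case: P => -[[x y]|] //= /eqP h; rewrite exprMn u2 h wa_eq wb_eq rmorphN.
by apply/eqP; ring.
Qed.

Definition twist_fun (P : point EK) : point E'K := Point (on_curve_twist P).

Lemma twist_regular P : exists F, represents_at twist_fun F P.
Proof.
have u0 : u != 0.
  by apply/eqP => u0; move/eqP: u2; rewrite u0 expr0n eq_sym oppr_eq0 oner_eq0.
exists (fun i : 'I_3 => nth 0 [:: - 1; u; 1] i *: 'X_i).
have evalE (Q : point EK) (i : 'I_3) :
    (nth 0 [:: - 1; u; 1] i *: 'X_i : {mpoly K[3]}).@[hcoord Q] =
    nth 0 [:: - 1; u; 1] i * hcoord Q i by rewrite mevalZ mevalXU.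
apply/represents_atP; split.
- by exists 1%N => i; apply: dhomogZ; rewrite dhomogX /= mdeg1.
- have [i hi] := hcoord_neq0 P; exists i; rewrite evalE mulf_neq0 //.
  by case: i {hi} => -[|[|[|]]] //= _; rewrite ?oppr_eq0 oner_eq0.
(* The scalar is 1 at affine points, but [u] at infinity, where [[0 : 1 : 0]] is sent to
   [[0 : u : 0]]. *)
- case=> -[[x y]|] hQ; [exists 1 | exists u] => i; rewrite evalE /hcoord /=;
    case: i => -[|[|[|]]] //= _; by rewrite ?mulN1r ?mul1r ?mulr1 ?mulr0 ?oppr0.
Qed.

Lemma twist_zero : twist_fun pzero = pzero.
Proof. exact: val_inj. Qed.

Definition twist_hom : ec_hom EK E'K := ECHom twist_regular twist_zero.

Lemma frob_twist_hom : u ^+ p = - u ->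
  forall P, frob_fun p_prime (twist_hom P) = popp (twist_hom (frob_fun p_prime P)).
Proof.
move=> up P; apply: val_inj; case: P => -[[x y]|] hP //=; congr (Some (_, _)).
  by rewrite -!(pFrobenius_autE (pchar_target iota p_prime)) rmorphN.
by rewrite exprMn up mulNr.
Qed.

End Map.

(** The inverse uses the other square root of -1, since the inverse of [u] is [- u]. *)
Lemma twist_homK (E E' : wcurve 'F_p) (u v : K) (u2 : u ^+ 2 = -1) (v2 : v ^+ 2 = -1)
    (wa_eq : wa E' = wa E) (wb_eq : wb E' = - wb E)
    (wa_eq' : wa E = wa E') (wb_eq' : wb E = - wb E') :
  v * u = 1 ->
  cancel (twist_hom u2 wa_eq wb_eq) (twist_hom v2 wa_eq' wb_eq').
Proof.
move=> vu [[[x y]|] hP]; apply: val_inj => //=.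
by rewrite opprK mulrA vu mul1r.
Qed.

End Twist.

Lemma twist_homN (p : nat) (K : closedFieldType) (iota : {rmorphism 'F_p -> K})
    (E E' : wcurve 'F_p) (u : K) (u2 : u ^+ 2 = -1)
    (wa_eq : wa E' = wa E) (wb_eq : wb E' = - wb E) (P : point (base_change iota E)) :
  twist_hom iota u2 wa_eq wb_eq (popp P) = popp (twist_hom iota u2 wa_eq wb_eq P).
Proof. by apply: val_inj; case: P => -[[x y]|] //= _; rewrite mulrN. Qed.

Lemma poppK (K : fieldType) (E : wcurve K) : involutive (@popp K E).
Proof. by case=> -[[x y]|] hP; apply: val_inj; rewrite //= opprK. Qed.

(** * The identity as a morphism defined over the subfield *)

Section Identity.

Variables (k K : fieldType) (iota : {rmorphism k -> K}) (E : wcurve k).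
Let EK := base_change iota E.

Lemma id_defined_over (P : point EK) :
  exists F : 'I_3 -> {mpoly k[3]}, represents_at id (fun i => map_mpoly iota (F i)) P.
Proof.
have evalE (Q : point EK) i : (map_mpoly iota 'X_i).@[hcoord Q] = hcoord Q i.
  by rewrite map_mpolyX mevalXU.
exists (fun i => 'X_i); apply/represents_atP; split.
- by exists 1%N => i; rewrite map_mpolyX dhomogX /= mdeg1.
- by have [i hi] := hcoord_neq0 P; exists i; rewrite evalE.
- by move=> Q; exists 1 => i; rewrite evalE mul1r.
Qed.

Lemma id_regular (P : point EK) : exists F, represents_at id F P.
Proof. by have [F hF] := id_defined_over P; exists (fun i => map_mpoly iota (F i)). Qed.

Definition id_hom : ec_end EK := ECHom id_regular erefl.

Lemma isomorphic_over_refl : isomorphic_over iota E E.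
Proof. by exists id_hom, id_hom; split=> //; apply: id_defined_over. Qed.

End Identity.

Theorem theorem3p10 (p n : nat) (K : closedFieldType)
    (iota : {rmorphism 'F_p -> K}) (K_alg : integralRange iota)
    (p_prime : prime p) (p_gt3 : (3 < p)%N) (p_mod4 : (p = 3 %[mod 4])%N)
    (n_gt0 : (1 <= n)%N)
    (E : wcurve 'F_p) (E_ss : supersingular iota E)
    (jE : jinv E != 1728) :
  (exists alpha : ec_end (base_change iota E),
     twisting p_prime alpha /\ has_degree alpha n)
  <->
  (exists (E' : wcurve 'F_p)
          (phi : ec_hom (base_change iota E) (base_change iota E')),
     [/\ isogeny phi, has_degree phi n, defined_over phi
       & isomorphic_over iota E' (twist E)]).
Proof.
have [u u2] := closed_field_exprS_surj 1 (-1 : K).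
have up : u ^+ p = - u.
  (* Here [u ^+ 4 = 1] and [u ^+ 3 = - u]. *)
  have -> : p = (4 * (p %/ 4) + 3)%N by rewrite mulnC [LHS](divn_eq p 4) p_mod4.
  rewrite exprD exprM (exprM u 2 2) u2 sqrrN !expr1n mul1r exprS u2.
  by rewrite mulrN1.
have v2 : (- u) ^+ 2 = -1 by rewrite sqrrN.
have vup : (- u) ^+ p = - - u.
  by rewrite -!(pFrobenius_autE (pchar_target iota p_prime)) rmorphN /= pFrobenius_autE up.
have uv : u * - u = 1 by rewrite mulrN -expr2 u2 opprK.
have vu : - u * u = 1 by rewrite mulrC.
(* This lets [tau'] end at [E] itself rather than at [twist (twist E)]. *)
have wbE : wb E = - wb (twist E) by rewrite opprK.
pose tau := twist_hom iota (E := E) (E' := twist E) u2 erefl erefl.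
pose tau' := twist_hom iota (E := twist E) (E' := E) v2 erefl wbE.
have tauK : cancel tau tau' by apply: twist_homK.
have tau'K : cancel tau' tau by apply: twist_homK.
split=> [[alpha [tw_alpha deg_alpha]]|[E' [phi [_ deg_phi def_phi [f [g [def_f _ fK gK]]]]]]].
- have [iso_phi deg_phi] := has_degree_comp_iso tauK tau'K n_gt0 deg_alpha.
  exists (twist E), (comp_hom alpha tau); split=> //; last exact: isomorphic_over_refl.
  move=> P; have [F hF] := hom_regular (comp_hom alpha tau) P.
  apply: (represents_at_descent _ K_alg hF) => Q /=.
  (* The sign from [tau] and the sign from [alpha] cancel, so the composite commutes with
     Frobenius. *)
  rewrite frob_twist_hom // [frob_fun _ (alpha _)](tw_alpha Q).
  by rewrite twist_homN poppK.
(* Conversely [alpha] is [phi] followed by [f] and [tau']; the isomorphism [f] then [tau'] has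
   inverse [tau] then [g]. *)
- have fgK : cancel (comp_hom f tau') (comp_hom tau g).
    by move=> P; rewrite -[LHS]/(g (tau (tau' (f P)))) tau'K fK.
  have gfK : cancel (comp_hom tau g) (comp_hom f tau').
    by move=> P; rewrite -[LHS]/(tau' (f (g (tau P)))) gK tauK.
  have [_ deg_alpha] := has_degree_comp_iso fgK gfK n_gt0 deg_phi.
  exists (comp_hom phi (comp_hom f tau')); split=> // P /=.
  (* [phi] and [f] commute with Frobenius, so [tau'] contributes the only sign. *)
  by rewrite frob_twist_hom // (frob_commute p_prime def_phi) (frob_commute p_prime def_f).
Qed.
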